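(* For every odd $n \in \mathbb{N}$ with $n \ge 5$, there exists an $(n,2)$-HSF $f_{n,2}$ with $\mathbf{D}[f_{n,2}] \in \left(1 + \Omega(n^{-1})\right)\mathbf{D}[f^*_{n,2}]$, i.e. there is an absolute constant $c>0$ such that $\mathbf{D}[f_{n,2}] \ge (1 + c/n)\,\mathbf{D}[f^*_{n,2}]$ for all such $n$.
   Context: A boolean function $f:\{-1,1\}^n\to\{-1,1\}$ is an $(n,d)$-PTF if there is a polynomial $p\in\mathbb{R}[x_1,\dots,x_n]$ of degree at most $d$ with $f(x)=\mathrm{sgn}(p(x))$ for all $x\in\{-1,1\}^n$. The dichromatic count $\mathbf{D}[f]$ is the number of unordered pairs $\{x,y\}$ of points of $\{-1,1\}^n$ differing in exactly one coordinate with $f(x)\ne f(y)$. Let $p^*_{n,d}$ be the monic univariate polynomial of degree $d$ with (non-repeated) roots at the $d$ integers closest to $0$ of opposite parity from $n$, and let $f^*_{n,d}(x)=\mathrm{sgn}\left(p^*_{n,d}\left(\sum_{i=1}^n x_i\right)\right)$. An $(n,d)$-HSF (hypersensitive function) is an $(n,d)$-PTF $f$ with $\mathbf{D}[f] > \mathbf{D}[f^*_{n,d}]$. *)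

(* Defs.v *)
From HB Require Import structures.
From mathcomp Require Import all_boot all_order all_algebra.
From mathcomp Require Import reals.
From mathcomp Require Import mpoly zify.

Set Implicit Arguments.
Unset Strict Implicit.
Unset Printing Implicit Defensive.

Import Order.TTheory GRing.Theory Num.Theory.
Local Open Scope ring_scope.

(* Signs are booleans throughout: b : bool stands for (-1) ^+ b, so that       *)
(* cube n is {-1,1}^n and f : cube n -> bool is a function into {-1,1}.        *)
Definition cube (n : nat) : finType := {ffun 'I_n -> bool}.

(* As Num.sg 0 = 0, the equation forces p to be nonzero on the cube.           *)
Definition is_PTF (R : realType) (n d : nat) (f : cube n -> bool) : Prop :=
  exists2 p : {mpoly R[n]}, (msize p <= d.+1)%N &
    forall x : cube n, (-1) ^+ f x = Num.sg p.@[fun i => (-1) ^+ x i].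

Definition adjacent (n : nat) (x y : cube n) : bool :=
  #|[set i : 'I_n | x i != y i]| == 1%N.

Definition dichromatic_count (n : nat) (f : cube n -> bool) : nat :=
  #|[set e : {set cube n} | [exists x : cube n, exists y : cube n,
       [&& e == [set x; y], adjacent x y & f x != f y]]]|.

(* The k-th (from k = 0) integer closest to 0 of parity opposite to n:         *)
(* 0, 2, -2, 4, -4, ... for n odd and 1, -1, 3, -3, ... for n even. When the   *)
(* d closest integers are not unique (e.g. n odd, d = 2) the tie is thus       *)
(* broken towards the positive one; see dichromatic_count_mirror.              *)
Definition star_root (n k : nat) : int :=
  if odd k == odd n then k.+1%:Z else - k%:Z.

Definition pstar (n d : nat) : {poly int} :=
  \prod_(k < d) ('X - (star_root n k)%:P).

Definition coord_sum (n : nat) (x : cube n) : int := \sum_(i < n) (-1) ^+ x i.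

Definition sgn_sym (n : nat) (p : {poly int}) (x : cube n) : bool :=
  p.[coord_sum x] < 0.

Definition fstar (n d : nat) : cube n -> bool := sgn_sym (pstar n d).

Definition is_HSF (R : realType) (n d : nat) (f : cube n -> bool) : Prop :=
  is_PTF R d f /\ (dichromatic_count (@fstar n d) < dichromatic_count f)%N.

Lemma star_root_parity n k : odd `|star_root n k| = ~~ odd n.
Proof.
by rewrite /star_root; case: eqP => [<-|] //=; rewrite ?abszN /=;
  case: (odd k); case: (odd n).
Qed.

Lemma star_root_inj n : injective (star_root n).
Proof. by move=> j k; rewrite /star_root; do 2![case: eqP]; lia. Qed.

Lemma star_root_closest n d (z : int) :
    odd `|z| = ~~ odd n -> (forall k, (k < d)%N -> z != star_root n k) ->
  forall k, (k < d)%N -> (`|star_root n k| <= `|z|)%N.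
Proof.
move=> zn zN k kd; rewrite leqNgt; apply/negP => ltz.
have kle : (`|star_root n k| <= k.+1)%N by rewrite /star_root; case: ifP; lia.
have [z0|z0] := ltP 0 z.
  have /eqP[] := zN `|z|.-1 ltac:(lia).
  by rewrite /star_root; case: eqP; lia.
have ez : z = - `|z|%:Z by lia.
have /eqP[] := zN `|z|%N ltac:(lia).
by rewrite /star_root zn; case: (odd n) => /=; lia.
Qed.

Lemma coord_sum_parity n (x : cube n) : odd `|coord_sum x| = odd n.
Proof.
rewrite /coord_sum.
have -> : \sum_(i < n) (-1) ^+ x i = n%:Z - (\sum_(i < n) x i).*2%:Z :> int.
  have -> : n%:Z = \sum_(i < n) 1 by rewrite sumr_const card_ord natz.
  rewrite -muln2 big_distrl /= -natz natr_sum -sumrB.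
  by apply: eq_bigr => i _; case: (x i).
lia.
Qed.

Lemma fstar_sgn n d (x : cube n) :
  (-1) ^+ fstar d x = Num.sg (pstar n d).[coord_sum x].
Proof.
rewrite /fstar /sgn_sym sgr_def; case: eqP => [|_]; last by rewrite mulr1n.
rewrite horner_prod => /eqP/prodf_eq0[k _].
rewrite hornerXsubC subr_eq0 => /eqP eqk.
by have := star_root_parity n k; rewrite -eqk coord_sum_parity; case: odd.
Qed.

Lemma dichromatic_count_le n (f g : cube n -> bool) (h : cube n -> cube n) b :
    injective h -> (forall x y, adjacent (h x) (h y) = adjacent x y) ->
    (forall x, g (h x) = b (+) f x) ->
  (dichromatic_count f <= dichromatic_count g)%N.
Proof.
move=> hI hA hfg.
rewrite /dichromatic_count -(card_imset _ (imset_inj hI)).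
apply/subset_leq_card/subsetP => e' /imsetP[e].
rewrite inE => /existsP[x /existsP[y /and3P[/eqP-> xy fxy]]] {e'}->.
rewrite inE; apply/existsP; exists (h x); apply/existsP; exists (h y).
rewrite imsetU !imset_set1 eqxx hA xy !hfg /=.
by move: fxy; case: (b); case: (f x); case: (f y).
Qed.

(* Replacing the roots of pstar by their opposites, i.e. breaking the tie the  *)
(* other way, does not change the dichromatic count.                           *)
Lemma dichromatic_count_mirror n d :
  dichromatic_count (sgn_sym (n := n) (\prod_(k < d) ('X + (star_root n k)%:P)))
  = dichromatic_count (@fstar n d).
Proof.
pose h (x : cube n) : cube n := [ffun i => ~~ x i].
have hK : involutive h by move=> x; apply/ffunP => i; rewrite !ffunE negbK.
have hI := inv_inj hK.
have hA x y : adjacent (h x) (h y) = adjacent x y.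
  congr (_ == _); apply: eq_card => i; rewrite !inE !ffunE.
  by case: (x i); case: (y i).
have hS x : coord_sum (h x) = - coord_sum x.
  rewrite /coord_sum -sumrN; apply: eq_bigr => i _.
  by rewrite ffunE; case: (x i).
have main x : sgn_sym (\prod_(k < d) ('X + (star_root n k)%:P)) (h x)
              = odd d (+) fstar d x.
  have E : (\prod_(k < d) ('X + (star_root n k)%:P)).[coord_sum (h x)]
           = (-1) ^+ d * (pstar n d).[coord_sum x].
    rewrite !horner_prod hS -[d in _ ^+ d]card_ord -prodrN.
    by apply: eq_bigr => k _; rewrite !hornerE opprB addrC.
  have := fstar_sgn d x; rewrite /fstar /sgn_sym E -(signr_odd _ d).
  case: (odd d); rewrite ?expr1 ?expr0 ?mulN1r ?mul1r /= ?oppr_lt0;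
    by case: (ltrgt0P (pstar n d).[coord_sum x]) => // ->; rewrite sgr0.
apply/eqP; rewrite eqn_leq; apply/andP; split; last first.
  exact: dichromatic_count_le hI hA main.
apply: (dichromatic_count_le (b := odd d) hI hA) => x.
by rewrite -[X in _ (+) sgn_sym _ X]hK main addKb.
Qed.

(* Main.v *)
Require Import Defs.
From mathcomp Require Import all_boot all_order all_algebra.
From mathcomp Require Import reals.
From mathcomp Require Import mpoly zify ring lra.
Local Open Scope ring_scope.

Set Implicit Arguments.
Unset Strict Implicit.
Unset Printing Implicit Defensive.

Import Order.TTheory GRing.Theory Num.Theory.

(** A function depending only on the numbers a and u of -1's inside and outside
    a block of coordinates has its dichromatic edges counted by a double sum
    over the profiles (a, u). Write n = 2m+3. The function f*_{n,2} is negative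
    exactly on one layer, an independent set of 'C(n, m+1) points, so
    D[f*] = n 'C(n, m+1). Now take a block of two coordinates, and let s and t
    be the sums of the coordinates inside and outside the block. On the cube,
    some quadratic in s and t is negative exactly for t = -1 when s = 2, for
    t = 1 when s = 0, and for t = 1 or -1 when s = -2. Its sign has
    dichromatic count (8m+9) 'C(2m+1, m), which is 1 + m / (2 n^2) times
    D[f*]. *)

Definition flip n (x : cube n) (i : 'I_n) : cube n :=
  [ffun j => x j (+) (j == i)].

Definition sensitivity n (f : cube n -> bool) (x : cube n) : nat :=
  #|[set i | f (flip x i) != f x]|.

Definition trues n (A : {set 'I_n}) (x : cube n) : {set 'I_n} :=
  [set i in A | x i].

Definition weight n (A : {set 'I_n}) (x : cube n) : nat := #|trues A x|.

Lemma flipK n (i : 'I_n) : involutive (fun x : cube n => flip x i).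
Proof. by move=> x; apply/ffunP => j; rewrite !ffunE addbK. Qed.

Lemma flip_inj n (x : cube n) : injective (flip x).
Proof.
by move=> i j /ffunP/(_ i); rewrite !ffunE eqxx => /addbI/esym/eqP.
Qed.

Lemma adjacentP n (x y : cube n) :
  reflect (exists i, y = flip x i) (adjacent x y).
Proof.
apply: (iffP cards1P) => -[i].
  move=> /setP E; exists i; apply/ffunP => j; have := E j.
  by rewrite !inE ffunE => <-; case: (x j); case: (y j).
move=> ->; exists i; apply/setP => j.
by rewrite !inE ffunE; case: (x j); case: (j == i).
Qed.

Lemma eq_dichromatic_count n (f g : cube n -> bool) :
  f =1 g -> dichromatic_count f = dichromatic_count g.
Proof.
move=> fg; apply: eq_card => e; rewrite !inE.
by under eq_existsb => x do under eq_existsb => y do rewrite !fg.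
Qed.

Lemma dichromatic_count_sensitivity n (f : cube n -> bool) :
  dichromatic_count f = (\sum_(x | f x) sensitivity f x)%N.
Proof.
pose directed := [set e : cube n * 'I_n | f e.1 && (f (flip e.1 e.2) != f e.1)].
pose edge (e : cube n * 'I_n) : {set cube n} := [set e.1; flip e.1 e.2].
have edge_inj : {in directed &, injective edge}.
  move=> [x i] [y j]; rewrite !inE /= => /andP[fx fxi] /andP[fy fyj] exy.
  have xy : x = y.
    have : x \in edge (y, j) by rewrite -exy !inE eqxx.
    by rewrite !inE => /orP[]/eqP //= xE; rewrite -xE fx fy in fyj.
  subst y; have : flip x i \in edge (x, j) by rewrite -exy !inE eqxx orbT.
  rewrite !inE => /orP[]/eqP /= => [xE|/flip_inj-> //].
  by rewrite xE eqxx in fxi.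
transitivity #|directed|; last first.
  rewrite -sum1_card; under [RHS]eq_bigr do rewrite /sensitivity -sum1_card.
  by rewrite pair_big_dep; apply: eq_bigl => -[x i]; rewrite !inE.
rewrite -(card_in_imset edge_inj); apply: eq_card => e; rewrite inE.
apply/existsP/imsetP => [[x /existsP[y /and3P[/eqP-> /adjacentP[i ->] ne]]]|].
  case fx: (f x) ne => ne.
    by exists (x, i); rewrite // inE /= fx eq_sym ne.
  exists (flip x i, i); last by rewrite /edge /= flipK setUC.
  by rewrite inE /= flipK fx; case: (f _) ne.
case=> -[x i]; rewrite inE /= => /andP[fx ne] ->.
exists x; apply/existsP; exists (flip x i); rewrite eqxx eq_sym ne andbT /=.
by apply/adjacentP; exists i.
Qed.

Lemma weight_flip n (A : {set 'I_n}) (x : cube n) i :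
  weight A (flip x i) =
  if i \in A then if x i then (weight A x).-1 else (weight A x).+1
  else weight A x.
Proof.
have rest : trues A (flip x i) :\ i = trues A x :\ i.
  by apply/setP => j; rewrite !inE ffunE; case: eqP; rewrite ?addbF.
rewrite /weight (cardsD1 i (trues A _)) (cardsD1 i (trues A x)) rest.
by rewrite !inE ffunE eqxx; case: (i \in A); case: (x i).
Qed.

Lemma weight_le n (A : {set 'I_n}) (x : cube n) : (weight A x <= #|A|)%N.
Proof. by apply/subset_leq_card/subsetP => i; rewrite inE => /andP[]. Qed.

Lemma sum_by_weight (V : nmodType) n (A : {set 'I_n}) (x : cube n)
    (F : bool -> V) :
  \sum_(i in A) F (x i)
  = F true *+ weight A x + F false *+ (#|A| - weight A x).
Proof.
have splitA : (#|A| - weight A x)%N = #|A :\: [set i | x i]|.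
  by rewrite /weight /trues -(cardsID [set i | x i] A) setIdE addKn.
rewrite (bigID (fun i => x i)) splitA /weight -!sumr_const /=; congr (_ + _).
  by apply: eq_big => [i|i /andP[_ ->] //]; rewrite !inE.
by apply: eq_big => [i|i /andP[_ /negPf->] //]; rewrite !inE andbC.
Qed.

Lemma sum_signs (R : pzRingType) n (A : {set 'I_n}) (x : cube n) :
  \sum_(i in A) (-1) ^+ x i = #|A|%:R - (weight A x).*2%:R :> R.
Proof.
rewrite (sum_by_weight _ _ (fun b : bool => (-1) ^+ b)) expr1 expr0.
by rewrite natrB ?weight_le // -addnn natrD opprD addrCA mulNrn.
Qed.

Lemma card_block_weights n (A : {set 'I_n}) a u :
  #|[set x : cube n | (weight A x == a) && (weight (~: A) x == u)]|
  = ('C(#|A|, a) * 'C(#|~: A|, u))%N.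
Proof.
have split_inj : injective (fun x => (trues A x, trues (~: A) x)).
  move=> x y [/setP eA /setP eAC]; apply/ffunP => i.
  by have := eA i; have := eAC i; rewrite !inE; case: (i \in A).
rewrite -!cards_draws -cardsX -(card_imset _ split_inj); apply: eq_card.
move=> [S T]; rewrite !inE /=; apply/imsetP/andP => [[x xau [-> ->]]|].
  move: xau; rewrite inE => /andP[xa xu].
  by split; apply/andP; split=> //; apply/subsetP => i; rewrite inE => /andP[].
case=> /andP[SA Sa] /andP[TA Tu].
pose x : cube n := [ffun i => i \in S :|: T].
have truesE B : trues B x = B :&: (S :|: T).
  by apply/setP => i; rewrite !inE ffunE inE.
have AT : A :&: T = set0.
  by apply: disjoint_setI0; rewrite disjoint_sym disjoints_subset.
have ACS : ~: A :&: S = set0.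
  by apply: disjoint_setI0; rewrite disjoint_sym disjoints_subset setCK.
have xS : trues A x = S by rewrite truesE setIUr AT setU0; apply/setIidPr.
have xT : trues (~: A) x = T by rewrite truesE setIUr ACS set0U; apply/setIidPr.
by exists x; rewrite ?xS ?xT // inE /weight xS xT Sa.
Qed.

Definition block_symmetric n (A : {set 'I_n}) (phi : nat -> nat -> bool)
    (x : cube n) : bool :=
  phi (weight A x) (weight (~: A) x).

(* For a = 0 the value at a.-1 is junk but has coefficient 0; likewise for u. *)
Definition profile_sensitivity (p q : nat) (phi : nat -> nat -> bool)
    (a u : nat) : nat :=
  ((phi a.-1 u != phi a u) * a + (phi a.+1 u != phi a u) * (p - a)
  + ((phi a u.-1 != phi a u) * u + (phi a u.+1 != phi a u) * (q - u)))%N.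

Lemma sensitivity_block_symmetric n (A : {set 'I_n}) phi (x : cube n) :
  sensitivity (block_symmetric A phi) x
  = profile_sensitivity #|A| #|~: A| phi (weight A x) (weight (~: A) x).
Proof.
rewrite /profile_sensitivity; set a := weight A x; set u := weight (~: A) x.
pose inner b : nat := phi (if b then a.-1 else a.+1) u != phi a u.
pose outer b : nat := phi a (if b then u.-1 else u.+1) != phi a u.
transitivity (\sum_(i in A) inner (x i) + \sum_(i in ~: A) outer (x i))%N.
  rewrite /sensitivity -sum1_card big_mkcond (bigID (fun i => i \in A)) /=.
  congr addn; apply: eq_big => [i|i iA]; rewrite ?inE //.
    by rewrite /block_symmetric !weight_flip inE iA /inner; case: (_ != _).
  rewrite /block_symmetric !weight_flip inE (negPf iA) /outer.
  by case: (_ != _).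
have -> := sum_by_weight A x inner; have -> := sum_by_weight (~: A) x outer.
have natmulE (b c : nat) : b *+ c = (b * c)%N by rewrite -mulr_natr natn.
by rewrite !natmulE.
Qed.

Lemma dichromatic_count_block_symmetric n (A : {set 'I_n}) phi :
  dichromatic_count (block_symmetric A phi)
  = (\sum_(0 <= a < #|A|.+1) \sum_(0 <= u < #|~: A|.+1 | phi a u)
      'C(#|A|, a) * 'C(#|~: A|, u)
      * profile_sensitivity #|A| #|~: A| phi a u)%N.
Proof.
rewrite dichromatic_count_sensitivity big_mkord.
under [RHS]eq_bigr do rewrite big_mkord.
rewrite pair_big_dep /=.
pose profile (x : cube n) : 'I_#|A|.+1 * 'I_#|~: A|.+1 :=
  (inord (weight A x), inord (weight (~: A) x)).
rewrite (partition_big profile (fun c => phi c.1 c.2)) /=; last first.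
  by move=> x; rewrite !inordK ?ltnS ?weight_le.
apply: eq_bigr => -[a u] /= phi_au.
rewrite -card_block_weights -sum1_card big_distrl /=.
apply: eq_big => x.
  rewrite inE xpair_eqE -!val_eqE /= !inordK ?ltnS ?weight_le //.
  rewrite andb_idl // => /andP[/eqP wa /eqP wu].
  by rewrite /block_symmetric wa wu.
rewrite xpair_eqE -!val_eqE /= !inordK ?ltnS ?weight_le // mul1n.
by move=> /and3P[_ /eqP<- /eqP<-]; apply: sensitivity_block_symmetric.
Qed.

Lemma dichromatic_count_layer n k :
  dichromatic_count (fun x : cube n => weight setT x == k) = (n * 'C(n, k))%N.
Proof.
pose layer := block_symmetric (set0 : {set 'I_n}) (fun _ u => u == k).
rewrite (@eq_dichromatic_count _ _ layer); last first.
  by move=> x; rewrite /layer /block_symmetric setC0.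
rewrite dichromatic_count_block_symmetric setC0 cards0 cardsT card_ord.
rewrite big_nat1 /= big_nat1_eq bin0 mul1n /profile_sensitivity.
have [nk|kn] := ltnP n k; first by rewrite bin_small // mul0n muln0; case: ifP.
by rewrite ltnS kn mulnC; congr (_ * _)%N; lia.
Qed.

Lemma coord_sum_weight n (x : cube n) :
  coord_sum x = n%:Z - (weight setT x).*2%:Z.
Proof.
have := sum_signs int setT x; rewrite cardsT card_ord !natz => <-.
by apply: eq_bigl => i; rewrite inE.
Qed.

Lemma fstar2E m (x : cube m.*2.+3) : fstar 2 x = (weight setT x == m.+1).
Proof.
have -> : fstar 2 x = (coord_sum x * (coord_sum x - 2) < 0).
  rewrite /fstar /sgn_sym /pstar !big_ord_recl big_ord0 mulr1.
  by rewrite /star_root /= odd_double /= !hornerE.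
by rewrite coord_sum_weight; apply/idP/eqP => [|->]; nia.
Qed.

Lemma dichromatic_count_fstar2 m :
  dichromatic_count (@fstar m.*2.+3 2) = (m.*2.+3 * 'C(m.*2.+3, m.+1))%N.
Proof.
by rewrite (eq_dichromatic_count (@fstar2E m)) dichromatic_count_layer.
Qed.

Lemma big_nat2_eq (T : Type) (idx : T) (op : Monoid.com_law idx) F i j n :
    (i < n)%N -> (j < n)%N -> i != j ->
  \big[op/idx]_(0 <= k < n | (k == i) || (k == j)) F k = op (F i) (F j).
Proof.
move=> lt_in lt_jn ij; rewrite (bigID (eq_op^~ i)) /=; congr (op _ _).
  rewrite (eq_bigl (eq_op^~ i)) ?big_nat1_eq ?lt_in // => k.
  by case: eqP; rewrite ?andbF.
rewrite (eq_bigl (eq_op^~ j)) ?big_nat1_eq ?lt_jn // => k.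
by case: (k =P j) => [->|]; case: eqP => // ji; rewrite ji eqxx in ij.
Qed.

(* The coordinates outside the block sum to t = 2m+1 - 2u, so the three cases
   are t = -1, t = 1, and t = 1 or -1. *)
Definition tilt_profile (m a u : nat) : bool :=
  match a with
  | 0 => u == m.+1
  | 1 => u == m
  | _ => (u == m) || (u == m.+1)
  end.

Lemma tilt_profile_sensitivity m :
  let sens := profile_sensitivity 2 m.*2.+1 (tilt_profile m) in
  [/\ sens 0 m.+1 = m.*2.+3, sens 1 m = m.*2.+2,
      sens 2 m = m & sens 2 m.+1 = m.+2]%N.
Proof. by rewrite /profile_sensitivity /=; split; lia. Qed.

Lemma msizeD_leq (R : nzRingType) n (p q : {mpoly R[n]}) k :
  (msize p <= k)%N -> (msize q <= k)%N -> (msize (p + q) <= k)%N.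
Proof.
by move=> pk qk; apply: leq_trans (mmeasureD_le _ _ _) _; rewrite geq_max pk.
Qed.

Lemma msizeM_leq (R : nzRingType) n (p q : {mpoly R[n]}) a b :
  (msize p <= a.+1)%N -> (msize q <= b.+1)%N -> (msize (p * q) <= (a + b).+1)%N.
Proof.
move=> pa qb; rewrite msizeE; apply/bigmax_leqP_seq => m + _.
move=> /msuppM_le/allpairsP[[m1 m2] /= [/msize_mdeg_lt m1p m2q ->]].
move/msize_mdeg_lt: m2q => m2q; rewrite mdegD ltnS leq_add // -ltnS.
  exact: leq_trans m1p pa.
exact: leq_trans m2q qb.
Qed.

Lemma msize_natr_leq (R : nzRingType) n c k :
  (msize (c%:R : {mpoly R[n]}) <= k.+1)%N.
Proof. by rewrite -mpolyC_nat mmeasureC; case: (_ != _). Qed.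

(* At s = 2, 0, -2 this is 4t^2+2t-4, 4t^2-2t-4, 4t^2-6t-12, negative among
   odd t only for t = -1, for t = 1, and for t = 1 or -1, respectively. *)
Definition tilt_quadratic (S : pzRingType) (s t : S) : S :=
  2 * t * (2 * t + s - 1) + s * (2 - s) - 4.

Lemma rmorph_tilt_quadratic (S T : pzRingType) (f : {rmorphism S -> T}) s t :
  f (tilt_quadratic s t) = tilt_quadratic (f s) (f t).
Proof.
by rewrite /tilt_quadratic !(rmorphB, rmorphD, rmorphM, rmorph1, rmorph_nat).
Qed.

Lemma msize_tilt_quadratic (R : nzRingType) n (s t : {mpoly R[n]}) :
  (msize s <= 2)%N -> (msize t <= 2)%N -> (msize (tilt_quadratic s t) <= 3)%N.
Proof.
move=> msize_s msize_t.
have msize_double_t : (msize (2 * t)%R <= 2)%N.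
  by apply: (@msizeM_leq _ _ _ _ 0 1); first exact: msize_natr_leq.
rewrite /tilt_quadratic; apply: msizeD_leq; last first.
  by rewrite mmeasureN msize_natr_leq.
apply: msizeD_leq; apply: (@msizeM_leq _ _ _ _ 1 1) => //.
  by do 2?[apply: msizeD_leq] => //; rewrite mmeasureN mmeasure1.
by apply: msizeD_leq; rewrite ?mmeasureN ?msize_natr_leq.
Qed.

Lemma tilt_quadratic_sgn m a u : (a <= 2)%N ->
  (-1) ^+ tilt_profile m a u
  = Num.sg (tilt_quadratic (2 - a.*2%:Z) (m.*2.+1%:Z - u.*2%:Z)).
Proof.
have signr_sg (b : bool) (y : int) :
    (if b then y < 0 else 0 < y) -> (-1) ^+ b = Num.sg y.
  by case: b => [/ltr0_sg|/gtr0_sg] ->.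
rewrite /tilt_quadratic => a2; apply: signr_sg.
have -> : m.*2.+1%:Z - u.*2%:Z = 2 * (m%:Z - u%:Z) + 1 by lia.
case: a a2 => [|[|[|//]]] _ /=.
- by case: eqP => [->|]; nia.
- by case: eqP => [->|]; nia.
by case: (u =P m) => [->|] /=; [|case: eqP => [->|]]; nia.
Qed.

Lemma mul_bin_middle m :
  (m.+2 * 'C(m.*2.+3, m.+1) = 2 * m.*2.+3 * 'C(m.*2.+1, m))%N.
Proof.
have /= up := mul_bin_diag m.*2.+3 m.
have /= down := mul_bin_down m.*2.+2 m.
have subE : (m.*2.+2 - m = m.+2)%N by lia.
apply/eqP; rewrite -(eqn_pmul2l (ltn0Sn m)) mulnCA -up mulnCA -subE -down.
by apply/eqP; lia.
Qed.

Definition tilt m (A : {set 'I_m.*2.+3}) : cube m.*2.+3 -> bool :=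
  block_symmetric A (tilt_profile m).

Section Tilt.
Variables (m : nat) (A : {set 'I_m.*2.+3}).
Hypothesis cardA : #|A| = 2%N.

Let cardAC : #|~: A| = m.*2.+1.
Proof. by rewrite cardsCs setCK cardA card_ord. Qed.

Lemma dichromatic_count_tilt :
  dichromatic_count (tilt A) = ((8 * m + 9) * 'C(m.*2.+1, m))%N.
Proof.
have [sens0 sens1 sens2_low sens2_high] := tilt_profile_sensitivity m.
have binSm : 'C(m.*2.+1, m.+1) = 'C(m.*2.+1, m).
  by rewrite -[LHS]bin_sub; [congr 'C(_, _)|]; lia.
have lt_m : (m < m.*2.+2)%N by lia.
have lt_mS : (m.+1 < m.*2.+2)%N by lia.
rewrite dichromatic_count_block_symmetric cardA cardAC big_mkord.
rewrite !big_ord_recl big_ord0 /= -[bump 0 (bump 0 0)]/2%N -[bump 0 0]/1%N.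
rewrite big_nat2_eq // ?ltn_eqF // !big_nat1_eq lt_m lt_mS /=.
rewrite sens0 sens1 sens2_low sens2_high binSm bin0 bin1 binn; nia.
Qed.

Lemma tilt_PTF (R : realType) : is_PTF R 2 (tilt A).
Proof.
pose block_sum (B : {set 'I_m.*2.+3}) : {mpoly R[m.*2.+3]} :=
  \sum_(i in B) 'X_i.
have msize_block_sum B : (msize (block_sum B) <= 2)%N.
  apply: leq_trans (mmeasure_sum _ _ _ _) _; apply/bigmax_leqP => i _.
  by rewrite msizeX mdeg1.
have block_sumE B (x : cube m.*2.+3) :
    (block_sum B).@[fun i => (-1) ^+ x i] = (#|B|%:Z - (weight B x).*2%:Z)%:~R.
  rewrite raddf_sum /=; under eq_bigr do rewrite mevalXU.
  by rewrite sum_signs rmorphB.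
exists (tilt_quadratic (block_sum A) (block_sum (~: A))).
  exact: msize_tilt_quadratic.
move=> x; rewrite (rmorph_tilt_quadratic (meval _)) /= !block_sumE.
rewrite -(rmorph_tilt_quadratic intr) -intr_sg cardA cardAC.
by rewrite -tilt_quadratic_sgn ?rmorph_sign // -cardA weight_le.
Qed.

Lemma dichromatic_count_tilt_ratio (R : numFieldType) :
  (dichromatic_count (tilt A))%:R
  = (1 + m%:R / (2 * m.*2.+3%:R ^+ 2))
    * (dichromatic_count (@fstar m.*2.+3 2))%:R :> R.
Proof.
have countE : (2 * m.*2.+3 ^ 2 * dichromatic_count (tilt A)
    = (2 * m.*2.+3 ^ 2 + m) * dichromatic_count (@fstar m.*2.+3 2))%N.
  rewrite dichromatic_count_tilt dichromatic_count_fstar2.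
  have := mul_bin_middle m; move: 'C(_, _) 'C(_, _) => C C' binE.
  have -> : (2 * m.*2.+3 ^ 2 + m = (8 * m + 9) * m.+2)%N by lia.
  transitivity ((8 * m + 9) * m.*2.+3 * (m.+2 * C'))%N; last by lia.
  by rewrite binE; lia.
have den_neq0 : 2 * m.*2.+3%:R ^+ 2 != 0 :> R.
  by rewrite mulf_neq0 ?expf_neq0 ?pnatr_eq0.
apply: (mulfI den_neq0); rewrite [RHS]mulrA mulrDr mulr1.
rewrite [_ * (m%:R / _)]mulrC divfK //.
by rewrite -natrX -!natrM -natrD -natrM countE.
Qed.

Lemma tilt_HSF (R : realType) : (0 < m)%N -> is_HSF R 2 (tilt A).
Proof.
move=> m_gt0; split; first exact: tilt_PTF.
rewrite -(ltr_nat R) dichromatic_count_tilt_ratio ltr_pMl.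
  by rewrite ltrDl divr_gt0 ?mulr_gt0 ?exprn_gt0 ?ltr0n.
by rewrite ltr0n dichromatic_count_fstar2 muln_gt0 bin_gt0; lia.
Qed.

End Tilt.

Theorem mainTheorem3 (R : realType) :
  exists2 c : R, 0 < c &
    forall n : nat, odd n -> (5 <= n)%N ->
      exists f : cube n -> bool,
        is_HSF R 2 f /\
        (1 + c / n%:R) * (dichromatic_count (@fstar n 2))%:R
          <= (dichromatic_count f)%:R :> R.
Proof.
exists 10^-1; first by rewrite invr_gt0.
move=> n n_odd n_ge5.
have [m m_gt0 ->] : exists2 m, (0 < m)%N & n = m.*2.+3.
  by exists (n./2.-1); lia.
have gain (x y : R) : 0 < x -> x <= 5 * y -> 10^-1 / x <= y / (2 * x ^+ 2).
  move=> x_gt0 le_x5y; rewrite ler_pdivlMr ?mulr_gt0 ?exprn_gt0 //.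
  by have -> : 10^-1 / x * (2 * x ^+ 2) = x / 5; [field; rewrite gt_eqF|lra].
have cardA : #|[set ord0; ord_max : 'I_m.*2.+3]| = 2%N by rewrite cards2.
exists (tilt [set ord0; ord_max]); split; first exact: tilt_HSF.
rewrite (dichromatic_count_tilt_ratio cardA) ler_wpM2r ?ler0n // lerD2l.
by apply: gain; rewrite ?ltr0n // -natrM ler_nat; lia.
Qed.
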